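(* Let $q\ge 2$ and $s\ge 0$ be fixed integers. Let $C_{q,s,n}$ be the maximum number of codewords in a $q$-ary $n$-symbol $s$-deletion correcting code. Then, as $n\to\infty$, $$C_{q,s,n} \lesssim \min_{0 \leq b \leq s} \frac{q^{n+b}}{(q-1)^s\binom{n}{s}\binom{s}{b}},$$ where $b$ ranges over integers.
   Context: $[q]=\{0,1,\dots,q-1\}$ and $[q]^n$ is the set of $q$-ary strings of length $n$. ''Substring'' means subsequence: $z\preceq x$ if $z$ is obtained from $x$ by deleting some (not necessarily contiguous) symbols while preserving order. For $x\in[q]^n$ and $s\le n$, $S_{s,0}(x)=\{z\in[q]^{n-s}: z\preceq x\}$. A $q$-ary $n$-symbol $s$-deletion correcting code is a set $C\subseteq[q]^n$ such that $S_{s,0}(x)\cap S_{s,0}(y)=\varnothing$ for all distinct $x,y\in C$. The notation $f(n)\lesssim g(n)$ means $\limsup_{n\to\infty} f(n)/g(n)\le 1$. *)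

(* Defs.v *)
From HB Require Import structures.
From mathcomp Require Import all_boot all_order all_algebra.
From mathcomp Require Import all_classical all_reals ereal topology normedtype sequences.

Set Implicit Arguments.
Unset Strict Implicit.
Unset Printing Implicit Defensive.

Import Order.TTheory GRing.Theory Num.Theory.

Local Open Scope ring_scope.

(* S_{s,0}(x). Since [n - s] is truncated, this is the intended object for
   [s <= n]; for [n < s] it is the singleton of the empty string. *)
Definition deletion_set (q n s : nat) (x : n.-tuple 'I_q) :
    {set (n - s).-tuple 'I_q} :=
  [set z : (n - s).-tuple 'I_q | subseq z x]%SET.

Definition deletion_code (q n s : nat) (C : {set n.-tuple 'I_q}) : bool :=
  [forall x in C, forall y in C,
     (x != y) ==> [disjoint deletion_set s x & deletion_set s y]].

Definition max_code_size (q s n : nat) : nat :=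
  (\max_(C : {set n.-tuple 'I_q} | deletion_code s C) #|C|)%N.

(* Equals 0 when [n < s], because ['C(n, s) = 0] and [0^-1 = 0]. *)
Definition code_bound (R : realType) (q s n b : nat) : R :=
  q%:R ^+ (n + b) / ((q%:R - 1) ^+ s * 'C(n, s)%:R * 'C(s, b)%:R).

(* [Num.min] has no neutral element in [R]; the term [b = 0] belongs to the
   range, so taking it as the initial value does not change the minimum. *)
Definition min_code_bound (R : realType) (q s n : nat) : R :=
  \big[Num.min/code_bound R q s n 0]_(b < s.+1) code_bound R q s n b.

(* The limsup is taken in [\bar R], so that an unbounded quotient has limsup
   [+oo]; the real-valued [limn_sup] is meaningless on unbounded sequences. *)
Definition asymp_le (R : realType) (f g : nat -> R) : Prop :=
  (limn_esup (fun n => (f n / g n)%:E) <= 1)%E.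

(* Main.v *)
Require Import Defs.
From mathcomp Require Import all_boot all_order all_algebra.
From mathcomp Require Import all_classical all_reals ereal topology normedtype sequences.
From mathcomp Require Import exp zify ring lra.

(* Put a = s - b. An s-deletion code also corrects a deletions combined with b
   insertions: the sets of words obtained from distinct codewords by a
   deletions and b insertions are disjoint subsets of [q]^(n+b-a). So it
   suffices to show that, for all but o(q^n / n^s) words x, there are
   asymptotically at least C(n,s) C(s,b) (q-1)^s / q^a such words.

   Cut x into a large constant number M of pieces, each made of a long body
   followed by a guard, and edit every body at most once. If no guard is
   2-periodic then different edits give different words: where two edited words
   first differ in length, the next guard would have to agree with its own
   translate by 1 or 2. A body B has as many one-deletion results as it has
   runs, which is about (q-1)|B|/q by a Chernoff bound, and at least (q-1)|B|
   one-insertion results. Counting the choices of bodies gives the lower bound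
   up to a factor tending to 1 as M grows. *)

Set Implicit Arguments.
Unset Strict Implicit.
Unset Printing Implicit Defensive.

Import Order.TTheory GRing.Theory Num.Theory.

Local Open Scope nat_scope.

(** * Strings obtained by isolated edits *)

Section Words.
Variable T : finType.
Implicit Types (s w x y z B G : seq T).

(** Deleting any symbol of a run gives the same word, so only the last symbol of each run is
    removed. The length of the list is thus the number of runs. *)
Fixpoint del1 s : seq (seq T) :=
  if s is c :: s' then
    (if ohead s' == Some c then [::] else [:: s']) ++ map (cons c) (del1 s')
  else [::].

(** A symbol is never put in front of an equal one: the same word arises by inserting it after the
    run. Each result is listed once. *)
Fixpoint ins1 s : seq (seq T) :=
  if s is c :: s' then
    [seq d :: s | d <- enum (predC1 c)] ++ map (cons c) (ins1 s')
  else [seq [:: d] | d <- enum T].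

Lemma uniq_del1 s : uniq (del1 s).
Proof.
elim: s => //= c s IH; rewrite cat_uniq map_inj_uniq ?IH ?andbT; last first.
  by move=> x y [].
case: eqP => //= hc; first by apply/hasPn.
by apply/hasPn => _ /mapP [y _ ->]; rewrite inE; apply/eqP => e; apply: hc; rewrite -e.
Qed.

Lemma uniq_ins1 s : uniq (ins1 s).
Proof.
elim: s => /= [|c s IH]; first by rewrite map_inj_uniq ?enum_uniq // => x y [].
rewrite cat_uniq !map_inj_uniq ?enum_uniq ?IH ?andbT //=; first last.
- by move=> x y [].
- by move=> x y [].
apply/hasPn => y /mapP [z _ ->]; apply/mapP => -[d].
by rewrite mem_enum => hd [hc _]; move: hd; rewrite -hc inE eqxx.
Qed.

Lemma size_ins1 s : size (ins1 s) = (size s).+1 * #|T|.-1 + (0 < #|T|).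
Proof.
elim: s => /= [|c s IH]; first by rewrite size_map -cardE; case: #|T| => // m;
  rewrite mul1n addn1.
by rewrite size_cat !size_map IH -cardE cardC1 addnA -mulSn.
Qed.

Lemma del1_sub s y : y \in del1 s -> subseq y s /\ (size y).+1 = size s.
Proof.
elim: s y => //= c s IH y; rewrite mem_cat => /orP[].
  by case: ifP => // _; rewrite inE => /eqP ->; split=> //; apply: subseq_cons.
by case/mapP => z /IH [hz <-] -> /=; rewrite eqxx.
Qed.

Lemma ins1_sub s y : y \in ins1 s -> subseq s y /\ size y = (size s).+1.
Proof.
elim: s y => [|c s IH] y.
  by case/mapP => d _ -> /=.
rewrite /= mem_cat => /orP[] /mapP [z].
  move=> _ -> ; split => //; exact: (subseq_cons (c :: s) z).
by move=> /IH [hz hs] -> /=; rewrite eqxx hs.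
Qed.

Definition period2 G := prefix (drop 2 G) G.

(** Dropping the first [size y'] symbols makes [G] overlap its translate by [d], where [d] is 1 or
    2. So [G] has period [d], and period 1 implies period 2. *)
Lemma shift_period2 y y' G z z' :
  1 < size G -> ~~ period2 G -> size y < size y' <= size y + 2 ->
  y ++ G ++ z <> y' ++ G ++ z'.
Proof.
move=> hG hp hy e.
set d := size y' - size y.
have hd : size y' = size y + d by rewrite /d; lia.
have e2 : drop d G ++ z = G ++ z'.
  have := congr1 (drop (size y')) e.
  rewrite [drop _ (y' ++ _)]drop_size_cat // hd drop_cat ltnNge leq_addr /= addKn => <-.
  rewrite drop_cat; case: ltnP => // h.
  have -> : d = size G by lia.
  by rewrite drop_size subnn drop0.
have pd : prefix (drop d G) G.
  have: prefix (drop d G) (G ++ z') by rewrite -e2 prefix_prefix.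
  rewrite !prefixE take_cat size_drop; case: ltnP => // h.
  have -> : size G - d - size G = 0 by lia.
  by rewrite take0 cats0 take_oversize //; lia.
apply/negP: hp; rewrite /period2.
have : d = 1 \/ d = 2 by lia.
case=> dE; rewrite dE in pd; last by rewrite pd.
apply/negPn/(prefix_trans _ pd).
have [t e1] := prefixP pd.
have -> : drop 1 G = drop 2 G ++ t.
  rewrite {1}e1 drop_cat size_drop; case: ltnP => [_|h]; first by rewrite drop_drop.
  have -> : 1 - (size G - 1) = 0 by lia.
  by rewrite drop0 drop_oversize //; lia.
exact: prefix_prefix.
Qed.

Section Edits.
Variables beta g : nat.

Definition splice (Y : seq (seq T)) G (Z : seq (seq T)) :=
  [seq y ++ G ++ z | y <- Y, z <- Z].

(* [x] is read as [k] blocks, each a body of length [beta] followed by a guard of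
   length [g], and a tail; [a] of the bodies lose a symbol and [b] gain one. *)
Fixpoint edits k x a b : seq (seq T) :=
  if k is k'.+1 then
    let B := take beta x in
    let G := take g (drop beta x) in
    let E := edits k' (drop g (drop beta x)) in
    splice [:: B] G (E a b)
      ++ (if a is a'.+1 then splice (del1 B) G (E a' b) else [::])
      ++ (if b is b'.+1 then splice (ins1 B) G (E a b') else [::])
  else if a + b == 0 then [:: x] else [::].

Fixpoint good D k x : bool :=
  if k is k'.+1 then
    [&& beta + g <= size x, D <= size (del1 (take beta x)),
        ~~ period2 (take g (drop beta x))
      & good D k' (drop g (drop beta x))]
  else true.

Lemma spliceP Y G Z u :
  reflect (exists y z, [/\ y \in Y, z \in Z & u = y ++ G ++ z])
          (u \in splice Y G Z).
Proof. exact: allpairsPdep. Qed.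

Lemma size_splice Y G Z : size (splice Y G Z) = size Y * size Z.
Proof. exact: size_allpairs. Qed.

Lemma uniq_splice n Y G Z : (forall y, y \in Y -> size y = n) ->
  uniq Y -> uniq Z -> uniq (splice Y G Z).
Proof.
move=> hY uY uZ; apply: allpairs_uniq => // -[y z] [y' z'].
case/allpairsPdep => [? [? [hy _ [-> _]]]].
case/allpairsPdep => [? [? [hy' _ [-> _]]]] /= /eqP.
rewrite eqseq_cat ?(hY _ hy) ?(hY _ hy') //= => /andP[/eqP -> ].
by rewrite eqseq_cat // eqxx => /eqP ->.
Qed.

Lemma splice_disjoint n n' Y Y' G Z Z' :
  1 < size G -> ~~ period2 G -> n < n' <= n + 2 ->
  (forall y, y \in Y -> size y = n) -> (forall y, y \in Y' -> size y = n') ->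
  forall u, u \in splice Y G Z -> u \in splice Y' G Z' -> False.
Proof.
move=> hG hp hn hY hY' u /spliceP [y [z [hy _ ->]]] /spliceP [y' [z' [hy' _]]].
by apply: shift_period2 => //; rewrite (hY _ hy) (hY' _ hy').
Qed.

(** The first body ends up with length [beta], [beta.-1] or [beta.+1]. Two different kinds differ
    there by 1 or 2 and are kept apart by the guard; within one kind the lengths agree, so the word
    parses uniquely. *)
Lemma uniq_edits D k x a b : 1 < g -> good D k x -> uniq (edits k x a b).
Proof.
move=> g1; elim: k x a b => [|k IH] x a b /=; first by case: ifP.
set B := take _ _; set G := take _ _; set r := drop _ _.
case/and4P => hs _ hp hr.
have sB : size B = beta by rewrite size_takel //; lia.
have sG : size G = g by rewrite size_takel // size_drop; lia.
have s0 y : y \in [:: B] -> size y = beta by rewrite inE => /eqP ->.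
have sD y : y \in del1 B -> size y = beta.-1.
  by case/del1_sub => _; rewrite sB; lia.
have sI y : y \in ins1 B -> size y = beta.+1 by case/ins1_sub => _; rewrite sB.
(* A deletion needs a nonempty body, so the truncated [beta.-1] is then strictly below [beta]. *)
have b0 y : y \in del1 B -> 0 < beta by case/del1_sub => _; rewrite sB; lia.
rewrite -sG in g1.
have U0 : uniq (splice [:: B] G (edits k r a b)).
  by apply: uniq_splice s0 _ _ => //; exact: IH.
have UD a' : uniq (splice (del1 B) G (edits k r a' b)).
  by apply: uniq_splice sD _ _; [exact: uniq_del1|exact: IH].
have UI b' : uniq (splice (ins1 B) G (edits k r a b')).
  by apply: uniq_splice sI _ _; [exact: uniq_ins1|exact: IH].
rewrite cat_uniq U0 /= cat_uniq has_cat negb_or -!andbA.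
apply/and5P; split.
- apply/hasPn => u; case: a {U0} UD UI => // a _ _ hu; apply/negP => hu'.
  have [y [_ [/b0 ? _ _]]] := spliceP _ _ _ _ hu.
  by apply: (splice_disjoint g1 hp _ sD s0 hu hu'); lia.
- apply/hasPn => u; case: b {U0} UD UI => // b _ _ hu; apply/negP => hu'.
  by apply: (splice_disjoint g1 hp _ s0 sI hu' hu); lia.
- by case: (a).
- apply/hasPn => u; case: b {U0} UD UI => // b _ _ hu; apply/negP => hu'.
  case: a hu hu' => // a hu hu'.
  have [y [_ [/b0 ? _ _]]] := spliceP _ _ _ _ hu'.
  by apply: (splice_disjoint g1 hp _ sD sI hu' hu); lia.
- by case: (b).
Qed.

(** The witness [w] is [x] after the deletions alone. *)
Lemma edits_sub k x a b z : z \in edits k x a b ->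
  exists w, [/\ subseq w x, subseq w z, size w + a = size x
              & size z + a = size x + b].
Proof.
elim: k x a b z => [|k IH] x a b z /=.
  case: eqP => // e; rewrite inE => /eqP ->; exists x.
  by split; rewrite ?subseq_refl //; lia.
set B := take _ _; set G := take _ _; set r := drop _ _.
have ex : x = B ++ G ++ r by rewrite !cat_take_drop.
(* Treats the three kinds of block at once: [y] replaces the body [B], and [v] is their common part,
   namely [y] for a deletion and [B] otherwise. *)
have step (y v : seq T) a' b' (z' : seq T) :
  subseq v B -> subseq v y -> z' \in edits k r a' b' ->
  exists w, [/\ subseq w x, subseq w (y ++ G ++ z'),
    size w + (size B - size v + a') = size x
    & size (y ++ G ++ z') + (size B - size v + a')
      = size x + (size y - size v + b')].
  move=> hv hy /IH [w [h1 h2 h3 h4]]; exists (v ++ G ++ w).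
  have ha : size v <= size B := size_subseq hv.
  have hb : size v <= size y := size_subseq hy.
  rewrite ex !cat_subseq ?subseq_refl // !size_cat; split=> //; lia.
rewrite mem_cat [X in _ || X]mem_cat => /or3P [].
- case/spliceP => y [z' [+ hz ->]]; rewrite inE => /eqP ->.
  have [w] := step _ _ _ _ _ (subseq_refl B) (subseq_refl B) hz.
  by rewrite !subnn; exists w.
- case: a => // a /spliceP [y [z' [/del1_sub [hy sy] hz ->]]].
  have [w] := step _ _ _ _ _ hy (subseq_refl y) hz.
  have -> : size B - size y + a = a.+1 by lia.
  by rewrite subnn; exists w.
- case: b => // b /spliceP [y [z' [/ins1_sub [hy sy] hz ->]]].
  have [w] := step _ _ _ _ _ (subseq_refl B) hy hz.
  have -> : size y - size B + b = b.+1 by lia.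
  by rewrite subnn; exists w.
Qed.

(** Choose the edited blocks, then those among them that lose a symbol. The induction is Pascal's
    rule applied to the first block. *)
Lemma size_edits D k x a b : good D k x ->
  'C(k, a + b) * 'C(a + b, a) * (D ^ a * (beta * #|T|.-1) ^ b)
    <= size (edits k x a b).
Proof.
elim: k x a b => [|k IH] x a b /=.
  by case: a b => [|a] [|b] //=.
set B := take _ _; set G := take _ _; set r := drop _ _.
case/and4P => hs hD _ /IH {}IH.
have sB : size B = beta by rewrite size_takel //; lia.
have sI : beta * #|T|.-1 <= size (ins1 B) by rewrite size_ins1 sB; lia.
rewrite size_cat [X in _ <= _ + X]size_cat size_splice mul1n.
set I := beta * _ in sI IH *.
have hd a' : 'C(k, a' + b) * 'C(a' + b, a') * (D ^ a'.+1 * I ^ b)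
    <= size (splice (del1 B) G (edits k r a' b)).
  rewrite size_splice expnS -[D * _ * _]mulnA mulnCA; exact: leq_mul (IH _ _).
have hi b' : 'C(k, a + b') * 'C(a + b', a) * (D ^ a * I ^ b'.+1)
    <= size (splice (ins1 B) G (edits k r a b')).
  rewrite size_splice expnS [D ^ a * _]mulnCA mulnCA; exact: leq_mul (IH _ _).
have h0 := IH a b.
case: a b {IH} hd hi h0 => [|a] [|b] hd hi h0.
- move: h0; rewrite !bin0 /=; lia.
- have {}hi := hi b; move: h0 hi; rewrite /= !add0n binS !bin0; lia.
- have {}hd := hd a; move: h0 hd; rewrite /= !addn0 !binn !muln1 binS; lia.
have {}hd := hd a; have {}hi := hi b; move: h0 hd hi => /=.
rewrite !addSn !addnS !binS; set X := D ^ _ * _ => h1 h2 h3.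
lia.
Qed.

End Edits.

(** Embeddings of [w1] and [w2] in [z] share at least [size w1 + size w2 - size z] positions. *)
Lemma common_subseq (w1 w2 z : seq T) m : subseq w1 z -> subseq w2 z ->
  m + size z <= size w1 + size w2 ->
  exists u, [/\ subseq u w1, subseq u w2 & size u = m].
Proof.
elim: z w1 w2 m => [|c z IH] w1 w2 m.
  by rewrite !subseq0 => /eqP -> /eqP -> /= h; exists [::]; split=> //=; lia.
case: m => [|m]; first by exists [::]; rewrite !sub0seq.
case: w1 => [|c1 w1].
  move=> _ h; have /= : size w2 <= size (c :: z) := size_subseq h; lia.
case: w2 => [|c2 w2].
  move=> h; have /= : size (c1 :: w1) <= size (c :: z) := size_subseq h; lia.
move=> /=; case: eqP => [->|_] h1; case: eqP => [->|_] h2 hs.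
- have [|u [hu1 hu2 su]] := IH w1 w2 m h1 h2; first lia.
  by exists (c :: u); rewrite /= !eqxx su.
- have [|u [hu1 hu2 su]] := IH w1 (c2 :: w2) m.+1 h1 h2; first by rewrite /=; lia.
  exists u; split=> //; exact: subseq_trans hu1 (subseq_cons _ _).
- have [|u [hu1 hu2 su]] := IH (c1 :: w1) w2 m.+1 h1 h2; first by rewrite /=; lia.
  exists u; split=> //; exact: subseq_trans hu2 (subseq_cons _ _).
- by have := IH (c1 :: w1) (c2 :: w2) m.+1 h1 h2; apply=> /=; lia.
Qed.

End Words.

(** * Counting exceptional strings *)

Section Counting.
Variable T : finType.

Lemma sum_tuple0 (V : nmodType) (F : seq T -> V) :
  (\sum_(x : 0.-tuple T) F x = F [::])%R.
Proof. by rewrite (big_pred1 [tuple]) // => x; exact/esym/eqP/tuple0. Qed.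

Lemma sum_tupleS (V : nmodType) n (F : seq T -> V) :
  (\sum_(x : n.+1.-tuple T) F x =
   \sum_(y : n.-tuple T) \sum_(c : T) F (c :: y))%R.
Proof.
rewrite pair_big /=.
rewrite (reindex (fun p : n.-tuple T * T => [tuple of p.2 :: p.1])) //=.
exists (fun x : n.+1.-tuple T => ([tuple of behead x], thead x)) => /= x _.
  by case: x => y c; congr pair => /=; apply: val_inj.
by rewrite -tuple_eta.
Qed.

Lemma sum_tuple_split (V : nmodType) m n (F : seq T -> seq T -> V) :
  (\sum_(x : (m + n).-tuple T) F (take m x) (drop m x) =
   \sum_(y : m.-tuple T) \sum_(z : n.-tuple T) F y z)%R.
Proof.
elim: m F => [|m IH] F.
  rewrite (sum_tuple0 (fun y => \sum_(z : n.-tuple T) F y z)%R) add0n.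
  by apply: eq_bigr => x _; rewrite take0 drop0.
rewrite addSn (sum_tupleS _ (fun x => F (take m.+1 x) (drop m.+1 x))).
rewrite (sum_tupleS _ (fun y => \sum_(z : n.-tuple T) F y z)%R).
under [RHS]eq_bigr => y _ do rewrite exchange_big.
rewrite -(IH (fun y z => \sum_(c : T) F (c :: y) z)%R) /=.
by apply: eq_bigr.
Qed.

Definition wcount n (P : pred (seq T)) := \sum_(x : n.-tuple T) (P x : nat).

Lemma wcountE n (P : pred (seq T)) :
  wcount n P = #|[set x : n.-tuple T | P x]|.
Proof. by rewrite cardsE -sum1_card [RHS]big_mkcond. Qed.

Lemma wcount_le_expn n (P : pred (seq T)) : wcount n P <= #|T| ^ n.
Proof. by rewrite wcountE -card_tuple max_card. Qed.

Lemma wcount_take m n (P : pred (seq T)) :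
  wcount (m + n) (fun x => P (take m x)) = wcount m P * #|T| ^ n.
Proof.
rewrite /wcount (sum_tuple_split m n (fun y _ => P y : nat)) big_distrl /=.
by apply: eq_bigr => y _; rewrite sum_nat_const card_tuple mulnC.
Qed.

Lemma wcount_drop m n (P : pred (seq T)) :
  wcount (m + n) (fun x => P (drop m x)) = #|T| ^ m * wcount n P.
Proof.
rewrite /wcount (sum_tuple_split m n (fun _ z => P z : nat)).
by rewrite sum_nat_const card_tuple.
Qed.

(** The first symbol of a 2-periodic word is forced by the third, so lengthening the word adds no
    choice. *)
Lemma wcount_period2 n : wcount n.+2 (@period2 T) <= #|T| ^ 2.
Proof.
elim: n => [|n IH]; first exact: wcount_le_expn.
apply: leq_trans IH; rewrite /wcount (sum_tupleS _ (fun x => period2 x : nat)).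
apply: leq_sum => -[[|d [|e w]] //= sw] _.
have E c : period2 [:: c, d, e & w] = (e == c) && period2 [:: d, e & w].
  by rewrite /period2 /= drop0.
under eq_bigr => c _ do rewrite E.
rewrite (bigD1 e) //= eqxx big1 => [|c /negPf]; first by rewrite addr0.
by rewrite eq_sym => ->.
Qed.

(** Union bound over the bodies and guards of the [k] blocks, with the denominators cleared. *)
Lemma wcount_good beta g D k t :
  #|T| ^ (beta + g) * wcount (k * (beta + g) + t) (fun x => ~~ good beta g D k x)
    <= k * (wcount beta (fun y => size (del1 y) < D) * #|T| ^ g
            + #|T| ^ beta * wcount g (@period2 T)) * #|T| ^ (k * (beta + g) + t).
Proof.
set bad := (X in _ * X * _).
elim: k => [|k IH].
  by rewrite /wcount big1 // muln0.
set N := k * (beta + g) + t in IH *.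
have eN : k.+1 * (beta + g) + t = beta + (g + N) by rewrite /N; lia.
rewrite eN.
have le : wcount (beta + (g + N)) (fun x => ~~ good beta g D k.+1 x) <=
    wcount (beta + (g + N)) (fun x => size (del1 (take beta x)) < D)
  + wcount (beta + (g + N)) (fun x => period2 (take g (drop beta x)))
  + wcount (beta + (g + N)) (fun x => ~~ good beta g D k (drop g (drop beta x))).
  rewrite -!big_split; apply: leq_sum => x _ /=.
  have -> /= : beta + g <= size x by rewrite size_tuple addnA leq_addr.
  rewrite ltnNge.
  by case: (D <= _); case: period2; case: good.
move: le; rewrite (wcount_take _ _ (fun y => size (del1 y) < D)).
rewrite (wcount_drop _ _ (fun y => period2 (take g y))) wcount_take.
rewrite (wcount_drop _ _ (fun y => ~~ good beta g D k (drop g y))).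
rewrite (wcount_drop _ _ (fun y => ~~ good beta g D k y)).
rewrite !expnD; move: IH; rewrite /bad !expnD.
set W := wcount N _; set W' := wcount (beta + _) _.
set d := wcount beta _; set p := wcount g _.
move: (#|T| ^ beta) (#|T| ^ g) (#|T| ^ N) => A G K IH le.
have := leq_mul (leqnn (A * G)) le; have := leq_mul (leqnn (A * G)) IH; lia.
Qed.

End Counting.

(** * Chernoff bound for the number of runs *)

Section Chernoff.
Local Open Scope ring_scope.
Variables (T : finType) (R : realFieldType).

(** A symbol prepended to a nonempty word starts a new run unless it repeats the first symbol, which
    gives exactly the base as factor. On the empty word the factor is [#|T|%:R * t], no larger since
    [t <= 1]. *)
Lemma sum_runs (t : R) n : (0 < #|T|)%N -> 0 <= t <= 1 ->
  \sum_(x : n.-tuple T) t ^+ size (del1 x) <= (1 + (#|T|%:R - 1) * t) ^+ n.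
Proof.
move=> Tp /andP[t0 t1]; elim: n => [|n IH].
  by rewrite (sum_tuple0 (fun x => t ^+ size (del1 x))) /= expr0.
rewrite (sum_tupleS _ (fun x => t ^+ size (del1 x))) exprS.
apply: le_trans (ler_wpM2l _ IH); last first.
  by rewrite addr_ge0 // mulr_ge0 // subr_ge0 ler1n.
rewrite big_distrr; apply: ler_sum => y _ /=.
under eq_bigr => c _ do rewrite size_cat size_map exprD.
rewrite -big_distrl /=; apply: ler_wpM2r; first exact: exprn_ge0.
have e1 : \sum_(c : T) t = #|T|%:R * t by rewrite sumr_const mulr_natl.
case: (tval y) => [|d w] /=.
  rewrite e1; nra.
rewrite (bigD1 d) //= eqxx expr0 lerD2l.
under eq_bigr => c hc do
  rewrite (inj_eq (@Some_inj _)) eq_sym (negPf hc) expr1.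
by move: e1; rewrite (bigD1 d) //= mulrBl mul1r => <-; rewrite addrAC subrr add0r.
Qed.

(** Each word with fewer than [D] runs contributes at least [t ^+ D] to the sum in [sum_runs]. *)
Lemma chernoff_runs (t : R) n D : (0 < #|T|)%N -> 0 < t <= 1 ->
  (wcount n (fun x : seq T => size (del1 x) < D)%N)%:R * t ^+ D
    <= (1 + (#|T|%:R - 1) * t) ^+ n.
Proof.
move=> Tp /andP[t0 t1]; apply: le_trans (sum_runs n Tp _); last by rewrite ltW.
rewrite natr_sum big_distrl /=; apply: ler_sum => x _.
case: ltnP => h; last by rewrite mul0r exprn_ge0 // ltW.
by rewrite mul1r; apply: ler_wiXn2l; [exact: ltW|done|exact: ltnW].
Qed.
End Chernoff.

(** * Packing *)

Section Codes.
Variables (q s n : nat).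

(** If [z] lies in [F x] and [F y], it contains two words of length [n - a]. As
    [2 (n - a) - (n + b - a) = n - s], these share a subsequence of length [n - s], common to [x]
    and [y], which forces [x = y]. *)
Lemma code_packing a b L (C A : {set n.-tuple 'I_q})
    (F : seq 'I_q -> seq (seq 'I_q)) :
  a + b = s -> s <= n -> deletion_code s C -> A \subset C ->
  (forall x, x \in A -> uniq (F x) /\ L <= size (F x)) ->
  (forall x : n.-tuple 'I_q, x \in A -> forall z, z \in F x -> exists w,
     [/\ subseq w x, subseq w z, size w + a = n & size z + a = n + b]) ->
  #|A| * L <= q ^ (n + b - a).
Proof.
move=> es sn hC AC hL hF.
set m := n + b - a.
pose S (x : n.-tuple 'I_q) := [set z : m.-tuple 'I_q | tval z \in F x].
have hS x : x \in A -> L <= #|S x|.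
  move=> xA; have [u hl] := hL x xA; apply: leq_trans hl _.
  rewrite cardE -(size_map (@tval _ _)); apply: uniq_leq_size => // z hz.
  have [w [_ _ _ sz]] := hF x xA z hz.
  have zm : size z == m by apply/eqP; rewrite /m; lia.
  by apply/mapP; exists (Tuple zm); rewrite // mem_enum inE.
have -> : q ^ m = \sum_(z : m.-tuple 'I_q) 1.
  by rewrite sum1_card card_tuple card_ord.
apply: (@leq_trans (\sum_(x in A) #|S x|)).
  by rewrite -sum_nat_const; apply: leq_sum.
under eq_bigr => x _ do rewrite -sum1_card big_mkcond /=.
(* Double counting: it remains to see that each [z] lies in at most one [S x]. *)
rewrite exchange_big /=; apply: leq_sum => z _.
rewrite -big_mkcondr /= sum1_card.
apply/card_le1_eqP => x y /andP[xA +] /andP[yA +]; rewrite !inE => xz yz.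
apply/eqP; apply: contraT => xy.
have [w1 [w1x w1z s1 sz]] := hF x xA _ xz.
have [w2 [w2y w2z s2 _]] := hF y yA _ yz.
have {}s1 : size w1 = n - a by rewrite -s1 addnK.
have {}s2 : size w2 = n - a by rewrite -s2 addnK.
have {}sz : size z = n + b - a by rewrite -sz addnK.
have [|u [u1 u2 su]] := common_subseq (m := n - s) w1z w2z.
  by rewrite s1 s2 sz; clear -es sn; lia.
have su' : size u == n - s by rewrite su.
have /forall_inP /(_ x (fintype.subsetP AC x xA)) := hC.
move=> /forall_inP /(_ y (fintype.subsetP AC y yA)); rewrite eq_sym xy /=.
move/pred0P => /(_ (Tuple su')); rewrite !inE /=.
by rewrite (subseq_trans u1 w1x) (subseq_trans u2 w2y).
Qed.

End Codes.

(** The good codewords are packed by their edits; the other codewords are at most all the words that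
    are not good. *)
Lemma code_size_bound q s n a b beta g k D t L (C : {set n.-tuple 'I_q}) :
  a + b = s -> s <= n -> 1 < g -> n = k * (beta + g) + t -> deletion_code s C ->
  L = 'C(k, s) * 'C(s, b) * (D ^ a * (beta * q.-1) ^ b) ->
  #|C| * L <= q ^ (n + b - a)
    + wcount n (fun x : seq 'I_q => ~~ good beta g D k x) * L.
Proof.
move=> es sn g1 en hC eL.
set A := [set x in C | good beta g D k x].
have hA : #|A| * L <= q ^ (n + b - a).
  apply: (@code_packing q s n a b L C A (fun x => edits beta g k x a b)) => //.
  - by apply/fintype.subsetP => x; rewrite inE => /andP[].
  - move=> x; rewrite inE => /andP[_ hx]; split; first exact: uniq_edits g1 hx.
    have := size_edits a b hx; rewrite card_ord es eL.
    have -> // : 'C(s, b) = 'C(s, a).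
    by rewrite -bin_sub -es ?addnK ?leq_addl.
  - move=> x _ z /edits_sub [w [h1 h2 h3 h4]]; exists w.
    by rewrite size_tuple in h3 h4.
apply: leq_trans (leq_add hA (leqnn _)); rewrite -mulnDl leq_mul2r.
apply/orP; right; rewrite wcountE -leq_subLR.
have <- : #|C :\: A| = #|C| - #|A|.
  rewrite cardsD; congr (_ - #|pred_of_set _|).
  by apply/finset.setIidPr/fintype.subsetP => x; rewrite inE => /andP[].
apply/subset_leq_card/fintype.subsetP => x; rewrite !inE => /andP[].
by case: (x \in C) => //=; rewrite andbF.
Qed.

(** * Asymptotics *)

Section PolyGeometric.
Local Open Scope ring_scope.
Variable R : rcfType.

Lemma bernoulli_ineq (h : R) n : 0 <= h -> 1 + n%:R * h <= (1 + h) ^+ n.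
Proof.
move=> h0; elim: n => [|n IH]; first by rewrite mul0r addr0.
rewrite exprS -natr1; have : 0 <= n%:R * h by rewrite mulr_ge0.
by move: IH; move: (_ ^+ n) (n%:R) => X m *; nra.
Qed.

(** With [x = y * y], one factor [y ^+ n] serves the induction hypothesis and the other absorbs the
    extra [n.+1]. *)
Lemma poly_geometric_bounded (x : R) s : 0 < x < 1 ->
  exists B, forall n, n.+1%:R ^+ s * x ^+ n <= B.
Proof.
elim: s x => [|s IH] x /andP[x0 x1].
  exists 1 => n; rewrite expr0 mul1r; apply: exprn_ile1; exact: ltW.
set y := Num.sqrt x.
have y0 : 0 < y by rewrite sqrtr_gt0.
have yy : y * y = x by rewrite -expr2 sqr_sqrtr // ltW.
have y1 : y < 1 by rewrite ltNge; apply/negP => y1; nra.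
have [|B hB] := IH y; first by rewrite y0.
(* Then [y = (1 + h)^-1], so Bernoulli's inequality bounds [y ^+ n] from above. *)
set h := y^-1 - 1.
have h0 : 0 < h by rewrite subr_gt0 invf_gt1.
exists (B * (1 + h^-1)) => n.
have -> : n.+1%:R ^+ s.+1 * x ^+ n = (n.+1%:R ^+ s * y ^+ n) * (n.+1%:R * y ^+ n).
  by rewrite -yy exprMn exprS; ring.
apply: ler_pM => //; try by rewrite mulr_ge0 // exprn_ge0 // ltW.
have e : y ^+ n = ((1 + h) ^+ n)^-1 by rewrite /h addrC subrK exprVn invrK.
rewrite e ler_pdivrMr; last by rewrite exprn_gt0 // addr_gt0.
have := bernoulli_ineq n (ltW h0) => hb.
apply: le_trans (ler_wpM2l _ hb); last by rewrite addr_ge0 // invr_ge0 ltW.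
have -> : (1 + h^-1) * (1 + n%:R * h) = n.+1%:R + (n%:R * h + h^-1).
  by rewrite -natr1; field; rewrite gt_eqF.
by rewrite lerDl addr_ge0 ?mulr_ge0 ?invr_ge0 // ltW.
Qed.
End PolyGeometric.

Local Open Scope ring_scope.

(** Boundedness with exponent [s.+1] leaves a spare factor [n.+1] to divide by. *)
Lemma poly_geometric_small (R : realType) (x e : R) s :
  0 < x < 1 -> 0 < e ->
  exists N, forall n, (N <= n)%N -> n.+1%:R ^+ s * x ^+ n <= e.
Proof.
move=> hx e0; have [B hB] := poly_geometric_bounded s.+1 hx.
exists (Num.bound (B / e)) => n hn.
have h1 : B / e < n.+1%:R.
  apply: lt_le_trans (archi_boundP _) _; last by rewrite ler_nat leqW.
  rewrite divr_ge0 ?(ltW e0) //; apply: le_trans (hB 0); by rewrite expr1n mulr1 ler01.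
have := hB n; rewrite exprS -mulrA.
set X := _ ^+ s * _ => h2.
rewrite -(@ler_pM2l _ n.+1%:R) ?ltr0Sn //; apply: le_trans h2 _.
by rewrite ltr_pdivrMr // in h1; exact: ltW.
Qed.

Lemma ffact_le_expn m s : (m ^_ s <= m ^ s)%N.
Proof.
elim: s => // s IH; rewrite ffactnSr expnSr; apply: leq_mul => //.
exact: leq_subr.
Qed.

Lemma expn_le_ffact m c s : (s <= c.+1)%N -> ((m - c) ^ s <= m ^_ s)%N.
Proof.
elim: s => // s IH h; rewrite ffactnSr expnSr; apply: leq_mul; last lia.
by apply: IH; lia.
Qed.

Section Asymptotics.
Variable R : realType.
Implicit Types (d e : R).

(** Compares [s] positions among [n] with [s] blocks among [M] and one of [w] items in each. It
    combines [n ^_ s <= n ^ s] with [(M - s) ^ s <= M ^_ s]. *)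
Lemma bin_le_scaled d n M w s : 0 <= d -> (s <= M)%N ->
  n%:R <= (1 + d) * ((M - s) * w)%:R ->
  'C(n, s)%:R <= (1 + d) ^+ s * ('C(M, s) * w ^ s)%:R.
Proof.
move=> d0 sM h.
have f0 : 0 < s`!%:R :> R by rewrite ltr0n fact_gt0.
rewrite -(ler_pM2r f0) -mulrA -!natrM bin_ffact mulnAC bin_ffact.
apply: (@le_trans _ _ (n%:R ^+ s)).
  by rewrite -natrX ler_nat ffact_le_expn.
apply: (@le_trans _ _ (((1 + d) * ((M - s) * w)%:R) ^+ s)).
  by apply: lerXn2r; rewrite ?nnegrE // mulr_ge0 // addr_ge0.
rewrite exprMn -natrX expnMn; apply: ler_wpM2l.
  by rewrite exprn_ge0 // addr_ge0.
by rewrite ler_nat leq_mul // expn_le_ffact.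
Qed.

(** The right side is the chord over [[0, 1]] of the convex function on the left. *)
Lemma exprD1_le d s : 0 <= d <= 1 -> (1 + d) ^+ s <= 1 + (2 ^+ s - 1) * d.
Proof.
case/andP => d0 d1; elim: s => [|s IH]; first by rewrite subrr mul0r addr0.
rewrite !exprS; have H : 1 <= 2 ^+ s :> R by rewrite exprn_ege1 // ler1n.
apply: le_trans (ler_wpM2l _ IH) _; first lra.
move: (2 ^+ s) H => y y1.
have : 0 <= (y - 1) * d * (1 - d) by rewrite !mulr_ge0 ?subr_ge0.
nra.
Qed.

Lemma exists_exprD1_le e s : 0 < e -> exists2 d, 0 < d & (1 + d) ^+ s <= 1 + e.
Proof.
move=> e0; have p0 : 0 < 2 ^+ s :> R by rewrite exprn_gt0.
exists (Num.min 1 (e / 2 ^+ s)); first by rewrite lt_min ltr01 divr_gt0.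
set d := Num.min _ _.
have d0 : 0 <= d by rewrite le_min ler01 divr_ge0 // ltW.
have d1 : d <= 1 by rewrite ge_min lexx.
have d2 : d * 2 ^+ s <= e by rewrite -ler_pdivlMr // ge_min lexx orbT.
apply: le_trans (exprD1_le s _) _; first by rewrite d0.
by nra.
Qed.

Lemma exists_square_ratio d c : 0 < d ->
  exists2 M : nat, (c < M)%N & (M.+1%:R) ^+ 2 <= (1 + d) * (M - c)%:R ^+ 2.
Proof.
(* After expansion with [m = M], the 3 pays for [2 * m + 1] in [(m + 1) ^+ 2], since [1 <= m], and
   the other term pays for the cross term of [(m - c) ^+ 2]. *)
move=> d0; set x := (3 + 2 * c%:R * (1 + d)) / d.
have x0 : 0 <= x by rewrite divr_ge0 ?(ltW d0) // addr_ge0 // !mulr_ge0 // addr_ge0 // ltW.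
exists (maxn c.+1 (Num.bound x)); first by rewrite leq_max ltnSn.
set M := maxn _ _.
have cM : (c < M)%N by rewrite leq_max ltnSn.
have : x < M%:R.
  by apply: lt_le_trans (archi_boundP x0) _; rewrite ler_nat leq_maxr.
rewrite /x ltr_pdivrMr // -(natr1 M) natrB; last exact: ltnW.
have : 1 <= M%:R :> R by rewrite ler1n; lia.
have : 0 <= c%:R :> R by [].
move: (M%:R : R) (c%:R : R) => m k k0 m1 h.
have : (3 + 2 * k * (1 + d)) * m <= m * d * m by rewrite ler_wpM2r //; lra.
have : 0 <= (1 + d) * k ^+ 2 by rewrite mulr_ge0 ?sqr_ge0 //; lra.
lra.
Qed.

Section Density.
Variables (q M : nat).
Hypotheses (q2 : (2 <= q)%N) (M1 : (1 <= M)%N).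
Let Q : R := q%:R.

(** The mean number of runs is about [(q - 1) * M * v]. The threshold is lower by the factor
    [1 - 1 / M], so falling short of it is exponentially unlikely in [v]. *)
Lemma few_runs_density : exists2 r : R, 0 < r < 1 & forall v,
  (wcount (q * M * v)
     (fun x : seq 'I_q => size (del1 x) < q.-1 * M.-1 * v)%N)%:R
  <= Q ^+ (q * M * v) * r ^+ v.
Proof.
have Q2 : 2 <= Q by rewrite ler_nat.
have Q0 : 0 < Q by lra.
pose m : R := M%:R.
have m1 : 1 <= m by rewrite ler1n.
have m0 : 0 < m by lra.
have m2 : 0 < m + 1 by lra.
(* Any [t = 1 / (1 + h)] with [M > (M - 1) (1 + h)] works; take [h = 1 / M]. *)
pose t := m / (m + 1).
have t0 : 0 < t by rewrite divr_gt0; lra.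
have t1 : t <= 1 by rewrite ler_pdivrMr; lra.
pose u := 1 + (Q - 1) * t.
have u0 : 0 < u by rewrite /u; nra.
(* The Chernoff bound divided by the number of words is the [v]-th power of this ratio. That it is
   below 1 follows from [1 + x <= expR x], applied to [u / Q] and [t^-1]. *)
exists ((u / Q) ^+ (q * M) / t ^+ (q.-1 * M.-1)).
  rewrite divr_gt0 ?exprn_gt0 ?divr_gt0 //=.
  have hu : u / Q <= expR (- ((Q - 1) / (Q * (m + 1)))).
    apply: le_trans (expR_ge1Dx _); rewrite le_eqVlt; apply/orP; left.
    by apply/eqP; rewrite /u /t; field; rewrite !gt_eqF //; lra.
  have ht : t^-1 <= expR m^-1.
    apply: le_trans (expR_ge1Dx _); rewrite le_eqVlt; apply/orP; left.
    by apply/eqP; rewrite /t; field; rewrite !gt_eqF //; lra.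
  rewrite -exprVn.
  apply: (@le_lt_trans _ _ (expR (- ((Q - 1) / (Q * (m + 1)))) ^+ (q * M) *
                     expR m^-1 ^+ (q.-1 * M.-1))).
    have uQ0 : 0 <= u / Q by rewrite divr_ge0 // ltW.
    have ti0 : 0 <= t^-1 by rewrite invr_ge0 ltW.
    by apply: ler_pM; rewrite ?exprn_ge0 //; apply: lerXn2r;
      rewrite ?nnegrE ?expR_ge0.
  rewrite -!expRM_natl -expRD expR_lt1.
  rewrite !natrM -!subn1 !natrB //; last exact: ltnW.
  rewrite -/Q -/m.
  have -> : Q * m * - ((Q - 1) / (Q * (m + 1))) + (Q - 1) * (m - 1) * m^-1
     = - ((Q - 1) / (m * (m + 1))).
    by field; rewrite !gt_eqF //; lra.
  by rewrite oppr_lt0 divr_gt0 ?mulr_gt0 //; lra.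
move=> v; have := @chernoff_runs 'I_q R t (q * M * v) (q.-1 * M.-1 * v).
rewrite card_ord t0 t1 => /(_ (ltnW q2) isT).
rewrite -ler_pdivlMr ?exprn_gt0 // => /le_trans; apply.
rewrite -/Q -/u; clearbody u t.
rewrite exprMn exprVn -!exprM mulrA -exprMn mulrCA divff ?mulr1 //.
by rewrite gt_eqF.
Qed.

End Density.
End Asymptotics.

(** * The asymptotic bound for a fixed number of insertions *)

Section Main.
Variable R : realType.

(** [wcount_good] in terms of densities: [r ^+ v] for a body with few runs and [q ^ 2 / q ^ v] for a
    2-periodic guard. *)
Lemma not_good_density (q M v D t n : nat) (r : R) :
  (1 < q)%N -> (1 < v)%N -> n = (M * (q * M * v + v) + t)%N ->
  (wcount (q * M * v)
     (fun x : seq 'I_q => size (del1 x) < D)%N)%:R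
    <= q%:R ^+ (q * M * v) * r ^+ v ->
  (wcount n (fun x : seq 'I_q => ~~ good (q * M * v) v D M x))%:R
    <= q%:R ^+ n * (M%:R * (r ^+ v + q%:R ^+ 2 * q%:R^-1 ^+ v)) :> R.
Proof.
move=> q1 v1 -> hd; set B := (q * M * v)%N in hd *.
have Q0 : 0 < q%:R :> R by rewrite ltr0n ltnW.
have hp : (wcount v (@period2 'I_q))%:R <= q%:R ^+ v * (q%:R ^+ 2 * q%:R^-1 ^+ v) :> R.
  rewrite mulrCA -exprMn divff ?gt_eqF // expr1n mulr1 -natrX ler_nat.
  case: v v1 {B hd} => [|[|v]] // _.
  by apply: leq_trans (wcount_period2 _ _) _; rewrite card_ord.
have := wcount_good 'I_q B v D M t; rewrite card_ord -(ler_nat R).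
rewrite !(natrM, natrD, natrX) exprD => H.
rewrite -(@ler_pM2l _ (q%:R ^+ B * q%:R ^+ v)); last by rewrite mulr_gt0 ?exprn_gt0.
apply: le_trans H _.
rewrite [leRHS]mulrCA [leLHS]mulrC; apply: ler_wpM2l.
  by rewrite exprn_ge0 // ltW.
rewrite [leRHS]mulrCA; apply: ler_wpM2l => //.
have pB : 0 <= q%:R ^+ B :> R by rewrite exprn_ge0 // ltW.
have pv : 0 <= q%:R ^+ v :> R by rewrite exprn_ge0 // ltW.
have := ler_wpM2r pv hd; have := ler_wpM2l pB hp; lra.
Qed.

Lemma max_code_sizeP q s n :
  exists2 C : {set n.-tuple 'I_q}, deletion_code s C & max_code_size q s n = #|C|.
Proof.
have [|C hC hm] := @eq_bigmax_cond _ [pred C | @deletion_code q n s C] (fun C => #|C|).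
  apply/card_gt0P; exists finset.set0; rewrite inE; apply/forall_inP => x.
  by rewrite inE.
by exists C.
Qed.

Lemma code_bound_gt0 q s n b : (2 <= q)%N -> (s <= n)%N -> (b <= s)%N ->
  0 < code_bound R q s n b.
Proof.
move=> q2 sn bs.
by rewrite divr_gt0 ?exprn_gt0 ?mulr_gt0 ?exprn_gt0 ?ltr0n ?bin_gt0 ?subr_gt0 ?ltr1n //; lia.
Qed.

(** With [w = q * M.-1 * v], a deletion factor times [q] equals [q.-1 * w], and an insertion factor
    is at least [q.-1 * w]. So all [s] edits can be compared with [w ^ s] through
    [bin_le_scaled]. *)
Lemma packing_term_le q s n a b M v (d : R) :
  (2 <= q)%N -> (a + b = s)%N -> (s <= M)%N -> 0 <= d -> (s <= n)%N ->
  n%:R <= (1 + d) * ((M - s) * (q * M.-1 * v))%:R ->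
  q%:R ^+ (n + b - a) <= (1 + d) ^+ s * code_bound R q s n b *
    ('C(M, s) * 'C(s, b) * ((q.-1 * M.-1 * v) ^ a * (q * M * v * q.-1) ^ b))%:R.
Proof.
move=> q2 es sM d0 sn hn.
have bs : (b <= s)%N by rewrite -es leq_addl.
have := bin_le_scaled d0 sM hn; set w := (q * M.-1 * v)%N.
set X := (1 + d) ^+ s => hX.
have X0 : 0 <= X by rewrite exprn_ge0 // addr_ge0.
rewrite /code_bound mulrA mulrAC ler_pdivlMr; last first.
  by rewrite !mulr_gt0 ?exprn_gt0 ?ltr0n ?bin_gt0 ?subr_gt0 ?ltr1n //.
have e1 : q%:R ^+ (n + b) = q%:R ^+ (n + b - a) * q%:R ^+ a :> R.
  by rewrite -exprD subnK //; lia.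
have q1E : q%:R - 1 = q.-1%:R :> R by rewrite -subn1 natrB // ltnW.
rewrite e1 q1E -!natrX -!natrM.
set P := (q ^ (n + b - a))%N.
have hL : ('C(M, s) * w ^ s * (q.-1 ^ s * 'C(s, b)) <=
   q ^ a * ('C(M, s) * 'C(s, b) * ((q.-1 * M.-1 * v) ^ a * (q * M * v * q.-1) ^ b)))%N.
  have : (M.-1 ^ b <= M ^ b)%N by case: (b) => // b'; rewrite leq_exp2r ?leq_pred.
  rewrite -es !expnD /w !expnMn.
  move: (M.-1 ^ b)%N (M ^ b)%N (M.-1 ^ a)%N => x y z xy.
  move: (q ^ a)%N (q ^ b)%N (v ^ a)%N (v ^ b)%N (q.-1 ^ a)%N (q.-1 ^ b)%N => q1 q3 v1 v2 q4 q5.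
  move: 'C(_, _) 'C(_, _) => c c'.
  by have := leq_mul (leqnn (c * c' * q1 * q3 * v1 * v2 * q4 * q5 * z)) xy; lia.
move: hL; set L := ('C(M, s) * 'C(s, b) * _)%N; rewrite -(ler_nat R) => hL.
have h1 := ler_wpM2l (ler0n R (P * (q.-1 ^ s * 'C(s, b)))) hX.
have h2 := ler_wpM2l (mulr_ge0 X0 (ler0n R P)) hL.
by move: h1 h2; rewrite !natrM; lra.
Qed.

(** Half of [e] covers the loss [(1 + d) ^+ s] in the packing term, the other half the words that
    are not good. *)
Lemma max_code_size_eventually q s b (e : R) : (2 <= q)%N -> (b <= s)%N -> 0 < e ->
  exists N, forall n, (N <= n)%N ->
    (max_code_size q s n)%:R <= (1 + e) * code_bound R q s n b.
Proof.
move=> q2 bs e0; have e20 : 0 < e / 2 by lra.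
have Q2 : 2 <= q%:R :> R by rewrite ler_nat.
have [d d0 hd] := exists_exprD1_le s e20.
(* Both [M - s] and [M.-1] will be bounded below by [M - s.+1]. *)
have [M sM hM] := exists_square_ratio s.+1 d0.
have M0 : (0 < M)%N by lia.
have [r hr hruns] := few_runs_density R q2 M0.
(* [M] blocks, with bodies of length [q M v] and guards of length [v = n / K]. *)
pose K := (M * (q * M).+1)%N.
have K0 : (0 < K)%N by rewrite muln_gt0 M0.
(* [c] is the denominator of [code_bound] with ['C(n, s)] replaced by [K ^ s], the factor [v.+1 ^ s]
   being left out; [f] adds the constants from [not_good_density]. *)
pose c : R := (q%:R - 1) ^+ s * K%:R ^+ s * 'C(s, b)%:R.
have c0 : 0 < c.
  by rewrite !mulr_gt0 ?exprn_gt0 ?ltr0n ?bin_gt0 ?subr_gt0 ?ltr1n.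
pose f : R := M%:R * c * (1 + q%:R ^+ 2).
have f0 : 0 < f.
  apply: mulr_gt0; first by rewrite mulr_gt0 // ltr0n.
  by rewrite ltr_wpDr // exprn_ge0.
have h0 : 0 < e / 2 / f by rewrite divr_gt0.
have hq : 0 < (q%:R^-1 : R) < 1 by rewrite invr_gt0 invf_lt1; lra.
have [N1 hN1] := poly_geometric_small s hr h0.
have [N2 hN2] := poly_geometric_small s hq h0.
(* [M <= v] will give [M * v.+1 <= v * M.+1], and [2 <= v] makes the guards long enough. *)
pose V := maxn (maxn N1 N2) (maxn M 2).
exists (K * V)%N => n hn.
pose v := (n %/ K)%N; pose t := (n %% K)%N.
have Vv : (V <= v)%N by rewrite leq_divRL // mulnC.
have en : n = (M * (q * M * v + v) + t)%N.
  by rewrite {1}(divn_eq n K) -/v -/t; move: (v) (t) => x y; rewrite /K; clear; lia.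
have nK : (n <= K * v.+1)%N.
  by rewrite {1}(divn_eq n K) -/v mulnS mulnC addnC leq_add2r ltnW ?ltn_pmod.
clearbody v t.
have [v1 v2 vM v3] : [/\ (N1 <= v)%N, (N2 <= v)%N, (M <= v)%N & (1 < v)%N].
  by move: Vv; rewrite /V !geq_max => /andP[/andP[-> ->] /andP[-> ->]].
have Mn : (M <= n)%N.
  apply: leq_trans hn; apply: leq_trans (leq_pmull _ K0).
  by rewrite /V !leq_max leqnn !orbT.
have sn : (s <= n)%N by clear -Mn sM; lia.
have cb0 := code_bound_gt0 q2 sn bs.
have [C hC ->] := max_code_sizeP q s n.
pose a := (s - b)%N; have es : (a + b = s)%N by rewrite subnK.
pose D := (q.-1 * M.-1 * v)%N.
have := code_size_bound es sn v3 en hC (erefl _) (D := D).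
set L := (_ * _ * _)%N.
have L0 : (0 < L)%N.
  rewrite !muln_gt0 !bin_gt0 bs !expn_gt0 !muln_gt0 /=.
  have [-> -> -> -> ->] : [/\ (0 < q)%N, (0 < q.-1)%N, (0 < M.-1)%N, (0 < v)%N & (s <= M)%N].
    by clear -q2 sM v3; split; lia.
  by rewrite M0.
have hn' : n%:R <= (1 + d) * ((M - s) * (q * M.-1 * v))%:R.
  apply: (@le_trans _ _ (q * v * M.+1 ^ 2)%:R).
    rewrite ler_nat; apply: leq_trans nK _; rewrite /K.
    have h1 : (M * v.+1 <= v * M.+1)%N by clear -vM; lia.
    have h2 : ((q * M).+1 <= q * M.+1)%N by clear -q2; lia.
    by have := leq_mul h1 h2; clear; lia.
  rewrite natrM natrX; apply: le_trans (ler_wpM2l (ler0n _ _) hM) _.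
  rewrite mulrCA; apply: ler_wpM2l; first lra.
  rewrite -natrX -natrM ler_nat.
  have h1 : (M - s.+1 <= M - s)%N by clear; lia.
  have h2 : (M - s.+1 <= M.-1)%N by clear; lia.
  by have := leq_mul (leqnn (q * v)) (leq_mul h1 h2); clear; lia.
have hp := packing_term_le q2 es (ltnW (ltnW sM)) (ltW d0) sn hn'.
have hb := not_good_density q2 v3 en (hruns v).
rewrite -/D -/L in hp hb *; clearbody L.
set W := wcount _ _ in hb *.
(* The density of the words that are not good is exponentially small in [v], while [code_bound] is
   at least [q ^ n] over a polynomial in [v]. *)
have hW : W%:R <= e / 2 * code_bound R q s n b.
  apply: le_trans hb _.
  rewrite /code_bound [leRHS]mulrA ler_pdivlMr; last first.
    by rewrite !mulr_gt0 ?exprn_gt0 ?ltr0n ?bin_gt0 ?subr_gt0 ?ltr1n.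
  have x1 := hN1 v v1; have x2 := hN2 v v2.
  have hC1 : 'C(n, s)%:R <= K%:R ^+ s * v.+1%:R ^+ s :> R.
    rewrite -exprMn -natrM -natrX ler_nat.
    apply: (@leq_trans (n ^ s)); last by case: (s) => // s'; rewrite leq_exp2r.
    by apply: leq_trans (ffact_le_expn _ _); rewrite -bin_ffact leq_pmulr ?fact_gt0.
  rewrite exprD [leRHS]mulrCA -[leLHS]mulrA; apply: ler_wpM2l; first by rewrite exprn_ge0.
  set g := _ + _.
  have g0 : 0 <= g.
    by rewrite addr_ge0 // ?mulr_ge0 ?exprn_ge0 ?invr_ge0 //; case/andP: hr => /ltW.
  have hg : v.+1%:R ^+ s * g <= (1 + q%:R ^+ 2) * (e / 2 / f).
    have := ler_wpM2l (exprn_ge0 2 (ler0n R q)) x2; rewrite /g; lra.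
  apply: (@le_trans _ _ (e / 2)); last first.
    by rewrite ler_peMr ?(ltW e20) // exprn_ege1 // ler1n ltnW.
  have Mc0 : 0 <= M%:R * c by rewrite mulr_ge0 // ltW.
  apply: le_trans (_ : M%:R * c * (v.+1%:R ^+ s * g) <= _); last first.
    apply: le_trans (ler_wpM2l Mc0 hg) _.
    by rewrite [leLHS]mulrA -/f [leLHS]mulrC divfK ?gt_eqF.
  have k0 : 0 <= M%:R * g * ((q%:R - 1) ^+ s * 'C(s, b)%:R).
    by rewrite !mulr_ge0 // exprn_ge0 //; lra.
  have := ler_wpM2l k0 hC1; rewrite /c; lra.
rewrite -(ler_nat R) !(natrD, natrM) natrX => hmain.
rewrite -(@ler_pM2r _ L%:R) ?ltr0n //; apply: le_trans hmain _.
have l0 : 0 < L%:R :> R by rewrite ltr0n.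
have := ler_wpM2r (ltW l0) hW.
have := ler_wpM2r (ltW l0) (ler_wpM2r (ltW cb0) hd).
lra.
Qed.

End Main.

(** * Passage to the limit superior *)

Lemma limn_esup_le_eventually (R : realType) (u : nat -> \bar R) (x : \bar R) N :
  (forall n, (N <= n)%N -> (u n <= x)%E) -> (limn_esup u <= x)%E.
Proof.
move=> h; apply: le_trans (ge_ereal_sup (S := [set u n | n in [set n | (N <= n)%N]]%classic) _).
  apply: ereal_inf_lbound; exists [set n | (N <= n)%N]%classic => //.
  exact: nbhs_infty_ge.
by move=> _ [n hn <-]; apply: h.
Qed.

Theorem theorem2 (R : realType) (q s : nat) (hq : (2 <= q)%N) :
  asymp_le (fun n => (max_code_size q s n)%:R : R)
           (fun n => min_code_bound R q s n).
Proof.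
apply/lee_addgt0Pr => e e0; have e1 : 0 < 1 + e by lra.
have /boolp.choice [N hN] : forall b : 'I_s.+1, exists N, forall n, (N <= n)%N ->
    (max_code_size q s n)%:R <= (1 + e) * code_bound R q s n b.
  by move=> b; apply: max_code_size_eventually => //; rewrite -ltnS.
(* From [s] on the bounds are positive, so no division by zero occurs; the maximum over the finitely
   many [b] gives a common start. *)
apply: (@limn_esup_le_eventually _ _ _ (maxn s (\max_b N b))) => n.
rewrite geq_max => /andP[sn Nn].
have g0 : 0 < min_code_bound R q s n.
  by apply: lt_bigmin => [|b _]; apply: code_bound_gt0; rewrite // -ltnS.
rewrite -EFinD lee_fin ler_pdivrMr // mulrC -ler_pdivrMr //.
have hb (b : 'I_s.+1) :
    (max_code_size q s n)%:R / (1 + e) <= code_bound R q s n b.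
  rewrite ler_pdivrMr // [leRHS]mulrC; apply: hN.
  exact: leq_trans (leq_bigmax b) Nn.
apply/bigmin_geP; split=> [|b _]; [exact: (hb ord0)|exact: hb].
Qed.
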